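(* Let $X=\prod_{i\in\mathbb{N}}X_i$ be a countable product of almost discrete (Tychonoff) spaces. Then $X$ is a Grothendieck space if and only if $t(X)=\omega$ and $X$ is Lindelöf.
   Context: A space is almost discrete if it has exactly one non-isolated point. $C_p(X)$ is the space of continuous real-valued functions on $X$ with the pointwise convergence topology. A space $Z$ is a $g$-space if every subset $A\subseteq Z$ such that every infinite subset of $A$ has an accumulation point in $Z$ has compact closure in $Z$. $X$ is Grothendieck if every subspace of $C_p(X)$ is a $g$-space. $t(X)$ denotes the tightness of $X$. *)

(* Defs.v *)
From HB Require Import structures.
From mathcomp Require Import all_boot all_order all_algebra.
From mathcomp Require Import all_classical all_reals all_analysis.
From mathcomp Require Import Rstruct Rstruct_topology.
Set Implicit Arguments. Unset Strict Implicit. Unset Printing Implicit Defensive.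
Import Order.TTheory GRing.Theory Num.Theory.
Local Open Scope classical_set_scope.

Definition completely_regular (T : topologicalType) : Prop :=
  forall (B : set T) (a : T), closed B -> ~ B a ->
    exists f : T -> Rdefinitions.R,
      [/\ continuous f, f a = 0%R & forall b, B b -> f b = 1%R].

Definition tychonoff_space (T : topologicalType) : Prop :=
  hausdorff_space T /\ completely_regular T.

Definition isolated (T : topologicalType) (x : T) : Prop := open [set x].

Definition almost_discrete (T : topologicalType) : Prop :=
  exists x : T, ~ isolated x /\ forall y : T, ~ isolated y -> y = x.

Definition Cp (X : topologicalType) : set {ptws X -> Rdefinitions.R} :=
  [set f | continuous (f : X -> Rdefinitions.R)].

(* The subspace Z of T is a g-space: every A ⊆ Z all of whose infinite subsets
   have an accumulation point in Z has compact closure in Z.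
   (Subspace notions written in the ambient space: accumulation point in Z =
   point of Z that is a limit point of B; closure in Z = closure A ∩ Z;
   compactness of a subspace = compactness of the subset.) *)
Definition g_space {T : topologicalType} (Z : set T) : Prop :=
  forall A : set T, A `<=` Z ->
    (forall B : set T, B `<=` A -> infinite_set B ->
       exists2 z, Z z & limit_point B z) ->
    compact (closure A `&` Z).

Definition grothendieck (X : topologicalType) : Prop :=
  forall Z : set {ptws X -> Rdefinitions.R}, Z `<=` @Cp X -> g_space Z.

Definition countable_tightness (X : topologicalType) : Prop :=
  forall (A : set X) (x : X), closure A x ->
    exists B : set X, [/\ B `<=` A, countable B & closure B x].

Definition lindelof (X : topologicalType) : Prop :=
  forall C : set (set X), (forall U, C U -> open U) ->
    \bigcup_(U in C) U = setT ->
    exists D : set (set X), [/\ D `<=` C, countable D & \bigcup_(U in D) U = setT].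

(* Main.v *)
(* Let p_i be the non-isolated point of X_i. A set S of points of the factors
   gives a continuous retraction r_S of X, replacing every coordinate outside S
   by p_i.

   If X is Grothendieck and g o r_S is continuous for all countable S, then the
   set of all functions g o r_S is countably compact, hence compact, hence
   contains its limit g: thus g = g o r_S for some countable S. Applied to
   indicators this shows that neighbourhoods of p_i are co-countable and that
   finite subproducts have countable tightness; the latter passes to X because
   basic open sets depend on finitely many coordinates. For the Lindelof
   property, fix one coordinate at a time to an isolated value outside a box of
   minimal length inside a member of the cover: an infinite descent converges to
   a point whose own box bounds the coordinates that can still be fixed.

   Conversely, let A be relatively countably compact in Z. It is pointwise
   bounded, countable tightness makes the functions of its closure continuous,
   and the Lindelof property makes every continuous function factor through a
   countable r_S. A closing-off argument then yields, for f in the closure of A,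
   a sequence of A all of whose cluster points are equal to f, so f is in Z. *)
Require Import Defs.
From HB Require Import structures.
From mathcomp Require Import all_boot all_order all_algebra.
From mathcomp Require Import all_classical all_reals all_analysis.
From mathcomp Require Import Rstruct Rstruct_topology.
From mathcomp Require Import lra.
Set Implicit Arguments. Unset Strict Implicit. Unset Printing Implicit Defensive.
Import Order.TTheory GRing.Theory Num.Theory.
Local Open Scope classical_set_scope.

Local Notation R := Rdefinitions.R.

(** * Neighbourhoods in products *)

Section product_neighbourhoods.
Context {I : choiceType} {T : I -> topologicalType}.
Implicit Types (x y : prod_topology T) (s : seq I).

Lemma nbhs_prod_box x s (V : forall i, set (T i)) :
  (forall i, i \in s -> nbhs (x i) (V i)) ->
  nbhs x [set y : prod_topology T | forall i, i \in s -> V i (y i)].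
Proof.
elim: s => [|j s IHs] xV; first by apply: filterE.
have xj : nbhs x (@proj I T j @^-1` V j).
  by apply: proj_continuous; apply: xV; exact: mem_head.
have xs : nbhs x [set y : prod_topology T | forall i, i \in s -> V i (y i)].
  by apply: IHs => i si; apply: xV; rewrite inE si orbT.
apply: filterS (filterI xj xs) => y [yj ys] i.
by rewrite inE => /orP[/eqP->//|]; exact: ys.
Qed.

Lemma nbhs_prodP x (U : set (prod_topology T)) : nbhs x U ->
  exists s (V : forall i, set (T i)), (forall i, nbhs (x i) (V i)) /\
    forall y, (forall i, i \in s -> V i (y i)) -> U y.
Proof.
(* The sets containing a box form a filter. The product topology is a supremum, so convergence of
   this filter to [x] can be tested one coordinate at a time. *)
pose F : set_system (prod_topology T) := fun U =>
  exists s (V : forall i, set (T i)), (forall i, nbhs (x i) (V i)) /\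
    forall y, (forall i, i \in s -> V i (y i)) -> U y.
have FF : Filter F.
  split.
  - by exists [::], (fun=> setT); split=> // i; exact: filterT.
  - move=> A B [s [V [xV VA]]] [t [W [xW WB]]].
    exists (s ++ t), (fun i => V i `&` W i); split=> [i|y yVW].
      exact: filterI.
    split; [apply: VA|apply: WB] => i ist.
      by have [] : (V i `&` W i) (y i) by apply: yVW; rewrite mem_cat ist.
    by have [] : (V i `&` W i) (y i) by apply: yVW; rewrite mem_cat ist orbT.
  - by move=> A B AB [s [V [xV VA]]]; exists s, V; split=> // y /VA/AB.
suff : F --> x by exact.
apply/cvg_sup => i A [B [[W oW WB] Bx BA]].
exists [:: i], (dfwith (fun=> setT) i W); split=> [j|y /(_ i)].
  case: dfwithP => [|k _]; last exact: filterT.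
  by apply: open_nbhs_nbhs; split=> //; move: Bx; rewrite -WB.
by rewrite mem_head dfwithin => /(_ isT) Wy; apply: BA; rewrite -WB.
Qed.

End product_neighbourhoods.

Section sequence_products.
Context {T : nat -> topologicalType}.
Implicit Types (x y : prod_topology T) (n : nat).

Lemma nbhs_seq_box x n (V : forall i, set (T i)) :
  (forall i, (i < n)%N -> nbhs (x i) (V i)) ->
  nbhs x [set y : prod_topology T | forall i, (i < n)%N -> V i (y i)].
Proof.
move=> xV.
have : nbhs x [set y : prod_topology T | forall i, i \in iota 0 n -> V i (y i)].
  by apply: nbhs_prod_box => i; rewrite mem_iota => /xV.
by apply: filterS => y yV i ni; apply: yV; rewrite mem_iota.
Qed.

Lemma nbhs_seqP x (U : set (prod_topology T)) : nbhs x U ->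
  exists n (V : forall i, set (T i)), (forall i, nbhs (x i) (V i)) /\
    forall y, (forall i, (i < n)%N -> V i (y i)) -> U y.
Proof.
move=> /nbhs_prodP[s [V [xV VU]]].
exists (\max_(i <- s) i.+1)%N, V; split=> // y yV; apply: VU => i si.
by apply: yV; rewrite (big_rem _ si)/= leq_max ltnSn.
Qed.

Lemma continuous_proj_seq i : continuous (fun x : prod_topology T => x i).
Proof. exact: (@proj_continuous nat T i). Qed.

End sequence_products.

Lemma nbhs_realP (r : R) (U : set R) :
  nbhs r U <-> exists2 e : R, (0 < e)%R & forall s : R, (`|s - r| < e)%R -> U s.
Proof.
split=> [/nbhs_ballP[e /= e0 eU]|[e e0 eU]].
  by exists e => // s sr; apply: eU; rewrite /ball/= distrC.
apply/nbhs_ballP; exists e => // s; rewrite /ball/= => sr.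
by apply: eU; rewrite distrC.
Qed.

Lemma continuous_at_realP (T : topologicalType) (f : T -> R) (x : T) :
  {for x, continuous f} <->
  forall e : R, (0 < e)%R -> nbhs x [set y | (`|f y - f x| < e)%R].
Proof.
split=> [fx e e0|fx U /nbhs_realP[e e0 eU]].
  by apply: (fx [set r : R | (`|r - f x| < e)%R]); apply/nbhs_realP; exists e.
by apply: filterS (fx e e0) => y; exact: eU.
Qed.

(** * The topology of pointwise convergence *)

Section pointwise_topology.
Context {X : topologicalType}.
Implicit Types f g : {ptws X -> R}.

Lemma accessible_ptws : accessible_space {ptws X -> R}.
Proof.
apply: hausdorff_accessible; apply: (@hausdorff_product X (fun=> R)) => _.
exact: Rhausdorff.
Qed.

Lemma nbhs_ptws_ball f (s : seq X) (e : R) : (0 < e)%R ->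
  nbhs f [set g : {ptws X -> R} | forall x, x \in s -> (`|g x - f x| < e)%R].
Proof.
move=> e0.
apply: (@nbhs_prod_box X (fun=> R) f s (fun x => [set r | (`|r - f x| < e)%R])).
by move=> x _; apply/nbhs_realP; exists e.
Qed.

Lemma nbhs_ptwsP f (U : set {ptws X -> R}) : nbhs f U ->
  exists (s : seq X) (e : R), (0 < e)%R /\
    forall g, (forall x, x \in s -> (`|g x - f x| < e)%R) -> U g.
Proof.
move=> /(@nbhs_prodP X (fun=> R))[s [V [fV VU]]].
have : exists e : R, (0 < e)%R /\
    forall x r, x \in s -> (`|r - f x| < e)%R -> V x r.
  elim: s {VU} => [|y s [e [e0 eV]]]; first by exists 1%R.
  have /nbhs_realP[d d0 dV] := fV y.
  exists (Num.min d e); split=> [|x r]; first by rewrite lt_min d0.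
  rewrite inE lt_min => /orP[/eqP->|xs] /andP[rd re]; last exact: eV.
  exact: dV.
move=> [e [e0 eV]]; exists s, e; split=> // g gf.
by apply: VU => x xs; apply: eV => //; exact: gf.
Qed.

End pointwise_topology.

(** * Cluster points of sequences in relatively countably compact sets *)

Section relative_countable_compactness.
Context {T : topologicalType}.
Variables A Z : set T.
Hypothesis T1 : accessible_space T.
Hypothesis AZ : A `<=` Z.
Hypothesis limA : forall B : set T, B `<=` A -> infinite_set B ->
  exists2 z, Z z & limit_point B z.

(** If the range is finite, some value recurs infinitely often. Otherwise a limit point of the range
    works: in a T1 space finitely many terms can be excluded, which forces large indices. *)
Lemma sequence_cluster_point (u : nat -> T) : (forall n, A (u n)) ->
  exists2 z, Z z & forall (U : set T) N, nbhs z U -> exists2 n, (N <= n)%N & U (u n).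
Proof.
move=> Au; have [finu|infu] := pselect (finite_set (range u)).
  have [[v [[k _ ukv] infv]]|noinf] := pselect
      (exists v, range u v /\ infinite_set [set n | u n = v]).
    exists v; first by rewrite -ukv; exact/AZ/Au.
    move=> U N Uv; apply: contrapT => /forall2NP NU; apply: infv.
    apply: sub_finite_set (finite_II N) => n /= unv.
    rewrite ltnNge; apply/negP => Nn; case: (NU n) => //; apply.
    by rewrite unv; exact: nbhs_singleton.
  have : finite_set (\bigcup_(v in range u) [set n | u n = v]).
    apply: bigcup_finite => // v uv; apply: contrapT => infv.
    by apply: noinf; exists v.
  move=> fin; exfalso; apply: infinite_nat.
  by apply: sub_finite_set fin => n _; exists (u n).
have [|z Zz limz] := limA _ infu; first by move=> _ [n _ <-].
exists z => // U N Uz.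
have : nbhs z [set y | forall k, (k < N)%N -> y = u k -> y = z].
  elim: N => [|N IHN]; first by apply: filterE.
  have zN : nbhs z [set y | y = u N -> y = z].
    have [->|zuN] := eqVneq (u N) z; first by apply: filterE => y ->.
    have /accessible_closed_set1/(_ (u N)) : accessible_space T by [].
    move=> /closed_openC oN; have : nbhs z (~` [set u N]).
      by apply: open_nbhs_nbhs; split=> // /= zE; rewrite zE eqxx in zuN.
    by apply: filterS => y /= + yN.
  apply: filterS (filterI zN IHN) => y [yN yk] k.
  by rewrite ltnS leq_eqVlt => /orP[/eqP->//|]; exact: yk.
move=> /(filterI Uz)/limz[y [yz [n _ uny] [Uy yN]]].
exists n; last by rewrite uny.
rewrite leqNgt; apply/negP => nN; move: yz; rewrite (yN n)//.
by rewrite eqxx.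
Qed.

End relative_countable_compactness.

(** * Retractions onto countable subproducts *)

Lemma countable_subset T (A B : set T) : A `<=` B -> countable B -> countable A.
Proof. by move=> /subset_card_le/sub_countable. Qed.

Lemma countable_image T U (f : T -> U) (A : set T) :
  countable A -> countable (f @` A).
Proof. exact: sub_countable (card_image_le f A). Qed.

Lemma countable_setU T (A B : set T) :
  countable A -> countable B -> countable (A `|` B).
Proof.
move=> cA cB; rewrite -bigcup2E; apply: bigcup_countable => // i _.
by case: i => [|[|i]].
Qed.

Lemma infinite_set_injection T (B : set T) : infinite_set B ->
  exists2 u : nat -> T, injective u & forall n, B (u n).
Proof.
elim/Ppointed: T => T in B *; first by rewrite emptyE => /infinite_setN0[].
move=> /infiniteP/pcard_leP/injfunPex[u Bu uinj]; exists u => [m n|n].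
  by apply: uinj; rewrite in_setT.
exact: Bu.
Qed.

Section almost_discrete_product.
Context {X : nat -> topologicalType}.
Variable p : forall i, X i.
Hypothesis isolatedX : forall i (y : X i), y <> p i -> open [set y].

Local Notation P := (prod_topology X).
Local Notation pts := {i : nat & X i}.
Local Notation pt i d := (existT (fun j => Topological.sort (X j)) i d).
Implicit Types (S : set pts) (x y z : P).

Lemma nbhs_isolated i (d : X i) (V : set (X i)) : d <> p i -> V d -> nbhs d V.
Proof.
move=> dp Vd; rewrite nbhsE; exists [set d]; last by move=> _ ->.
by split=> //; exact: isolatedX.
Qed.

Definition retract S x : P := fun i => if `[< S (pt i (x i)) >] then x i else p i.

Lemma retract_in S x i : S (pt i (x i)) -> retract S x i = x i.
Proof. by move=> Sx; rewrite /retract asboolT. Qed.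

Lemma retract_notin S x i : ~ S (pt i (x i)) -> retract S x i = p i.
Proof. by move=> Sx; rewrite /retract asboolF. Qed.

Lemma retract_ind S x i (V : set (X i)) : V (x i) -> V (p i) -> V (retract S x i).
Proof. by rewrite /retract; case: asboolP. Qed.

Lemma retract_sub S S' x : S' `<=` S -> retract S (retract S' x) = retract S' x.
Proof.
move=> S'S; apply: functional_extensionality_dep => i.
rewrite {1}/retract; case: asboolP => // nS.
have [S'x|S'x] := pselect (S' (pt i (x i))); last by rewrite retract_notin.
by exfalso; apply: nS; rewrite retract_in//; exact: S'S.
Qed.

(** Where [x i] is [p i], a neighbourhood of [p i] is mapped into itself, since its points are kept
    or sent to [p i]. At any other coordinate [x i] is isolated. *)
Lemma continuous_retract S : continuous (retract S : P -> P).
Proof.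
move=> x U /nbhs_seqP[n [V [xV VU]]].
pose W i := [set d : X i | V i (if `[< S (pt i d) >] then d else p i)].
have : nbhs x [set y : P | forall i, (i < n)%N -> W i (y i)].
  apply: nbhs_seq_box => i _; have := xV i; have [xp|xp] := pselect (x i = p i).
    have -> : retract S x i = x i by exact: (@retract_ind S x i (fun d => d = x i)).
    move=> xiV; have Vp : V i (p i) by rewrite -xp; exact: nbhs_singleton.
    by apply: filterS xiV => d Vd; rewrite /W/=; case: ifP.
  by move=> /nbhs_singleton xiV; exact: nbhs_isolated.
by apply: filterS => y yW; apply: VU => i /yW.
Qed.

Lemma continuous_comp_retract (f : P -> R) S : continuous f ->
  continuous (fun x => f (retract S x)).
Proof.
move=> cf x; apply: (@continuous_comp P P R (retract S) f); last exact: cf.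
exact: continuous_retract.
Qed.

(** * Consequences of the Grothendieck property *)

Section Grothendieck.
Hypothesis groX : grothendieck P.

(* Sets S_n of points converge along a nonprincipal ultrafilter, to the set of
   points lying in almost all S_n; hence so do the functions g o r_{S_n}. *)
Lemma countable_retracts_factor (g : P -> R) :
  (forall S, countable S -> continuous (fun x => g (retract S x))) ->
  exists2 S, countable S & forall x, g (retract S x) = g x.
Proof.
move=> cg.
pose Z : set {ptws P -> R} :=
  [set f | exists2 S, countable S & f = (fun x => g (retract S x))].
have ZC : Z `<=` @Cp P by move=> _ [S cS ->]; exact: cg.
have limZ (B : set {ptws P -> R}) : B `<=` Z -> infinite_set B ->
    exists2 z, Z z & limit_point B z.
  move=> BZ /infinite_set_injection[u uinj Bu].
  have /choice[Sn Snu] : forall n, exists S,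
      countable S /\ u n = (fun x => g (retract S x)).
    by move=> n; have [S cS uS] := BZ _ (Bu n); exists S.
  have [G [GU ooG]] := ultraFilterLemma (@eventually_filter).
  pose S' : set pts := [set d | G [set n | Sn n d]].
  pose S : set pts := \bigcup_n Sn n.
  have cS : countable S by apply: bigcup_countable => // n _; have [] := Snu n.
  have SnS n : Sn n `<=` S by move=> d; exists n.
  have S'S : S' `<=` S by move=> d /filter_ex[n Snd]; exists n.
  exists (fun x => g (retract S' x)).
    by exists S' => //; exact: countable_subset S'S cS.
  have Gu x (e : R) : (0 < e)%R ->
      G [set n | (`|u n x - g (retract S' x)| < e)%R].
    move=> e0.
    (* The union [S] of all [Sn n] serves every [n] at once: [retract S] fixes the points
       [retract (Sn n) x] and [retract S' x]. *)
    have := (continuous_at_realP _ _).1 (cg S cS (retract S' x)) e e0.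
    move=> /nbhs_seqP[m [V [xV VU]]].
    have : G [set n | forall i, (i < m)%N -> retract (Sn n) x i = retract S' x i].
      elim: m {VU} => [|m IHm]; first exact: filterE.
      have Gm : G [set n | retract (Sn n) x m = retract S' x m].
        have [xS'|xS'] := pselect (S' (pt m (x m))).
          by have := xS'; apply: filterS => n Snx /=; rewrite !retract_in//.
        have [//|] := in_ultra_setVsetC [set n | Sn n (pt m (x m))] GU.
        by apply: filterS => n /= Snx; rewrite !retract_notin.
      apply: filterS (filterI Gm IHm) => n [nm nk] i.
      by rewrite ltnS leq_eqVlt => /orP[/eqP->//|]; exact: nk.
    apply: filterS => n eqn /=; have [_ ->] := Snu n.
    have := VU (retract (Sn n) x); rewrite /= !retract_sub//.
    by apply => i /eqn ->; exact: nbhs_singleton (xV i).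
  move=> U /nbhs_ptwsP[s [e [e0 sU]]].
  have GU' : G [set n | U (u n)].
    have : G [set n | forall x, x \in s -> (`|u n x - g (retract S' x)| < e)%R].
      elim: s {sU} => [|y s IHs]; first exact: filterE.
      apply: filterS (filterI (Gu y e e0) IHs) => n [ny ns] x.
      by rewrite inE => /orP[/eqP->//|]; exact: ns.
    by apply: filterS => n; exact: sU.
  (* As [u] is injective, the limit occurs at most once among the [u n], and the nonprincipal
     ultrafilter avoids that index. *)
  have Gneq : G [set n | u n <> (fun x => g (retract S' x))].
    have [[k uk]|nou] := pselect (exists k, u k = (fun x => g (retract S' x))).
      apply: ooG; exists k.+1 => // n /= kn un.
      by move: kn; rewrite (uinj n k) ?ltnn// un uk.
    by apply: filterE => n /= un; apply: nou; exists n.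
  have [n [Un neqn]] := filter_ex (filterI GU' Gneq).
  by exists (u n); split=> //; exact/eqP.
have Zclosed : closed Z.
  apply: compact_closed.
    by apply: (@hausdorff_product P (fun=> R)) => _; exact: Rhausdorff.
  have := groX ZC (fun _ h => h) limZ; congr compact.
  by apply/seteqP; split=> [f []//|f Zf]; split=> //; exact: subset_closure.
suff : Z g by move=> [S cS gS]; exists S => // x; rewrite [in RHS]gS.
apply: Zclosed => U /nbhs_ptwsP[s [e [e0 sU]]].
(* The coordinates of the finitely many test points form a countable set, whose retraction fixes
   these points. *)
pose S : set pts := [set d | exists2 x, x \in s & exists i, d = pt i (x i)].
have cS : countable S.
  have -> : S = \bigcup_(x in [set` s]) range (fun i => pt i (x i)).
    apply/seteqP; split=> [d [x xs [i ->]]|d [x xs [i _ <-]]].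
      by exists x => //; exists i.
    by exists x => //; exists i.
  apply: bigcup_countable => [|x _]; first exact/finite_set_countable/finite_seq.
  exact: countable_image.
exists (fun x => g (retract S x)); split; first by exists S.
apply: sU => x xs; suff -> : retract S x = x by rewrite subrr normr0.
apply: functional_extensionality_dep => i; rewrite retract_in//.
by exists x => //; exists i.
Qed.

Definition cocountable_nbhs :=
  forall i (U : set (X i)), open U -> U (p i) -> countable (~` U).

(** The indicator of the complement of [U] is continuous, because all points other than [p i] are
    isolated. It factors through a countable [S]; a value outside both [U] and [S] would be sent to
    [p i], which lies in [U]. *)
Lemma grothendieck_cocountable : cocountable_nbhs.
Proof.
move=> i U oU Up.
pose h (d : X i) : R := if `[< U d >] then 0%R else 1%R.
have ch : continuous (fun x : P => h (x i)).
  move=> x; apply: (@continuous_comp P (X i) R (fun x => x i) h).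
    exact: continuous_proj_seq.
  apply/continuous_at_realP => e e0.
  have [Ux|nUx] := pselect (U (x i)).
    have : nbhs (x i) U by exact: open_nbhs_nbhs.
    by apply: filterS => d Ud; rewrite /= /h !asboolT// subrr normr0.
  apply: nbhs_isolated; first by move=> xp; apply: nUx; rewrite xp.
  by rewrite /= subrr normr0.
have [S cS hS] := countable_retracts_factor (g := fun x => h (x i))
  (fun S _ => continuous_comp_retract (S := S) ch).
suff : ~` U `<=` (fun d : X i => S (pt i d)).
  move=> /countable_subset; apply; have /countable_injP[f finj] := cS.
  apply/countable_injP; exists (fun d => f (pt i d)) => d d' /set_mem Sd /set_mem Sd'.
  move=> /(finj _ _ (mem_set Sd) (mem_set Sd')) /eqP.
  by rewrite eq_Tagged /= => /eqP.
move=> d nUd; have := hS (dfwith p i d); rewrite /= dfwithin.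
have [Sd|nSd] := pselect (S (pt i d)) => //.
rewrite retract_notin ?dfwithin// /h asboolT// asboolF// => /esym/eqP.
by rewrite oner_eq0.
Qed.

End Grothendieck.
End almost_discrete_product.

(** * The Lindelof property *)

Section Lindelof.
Context {X : nat -> topologicalType}.
Variable p : forall i, X i.
Local Notation P := (prod_topology X).
Local Notation pts := {i : nat & X i}.
Local Notation pt i d := (existT (fun j => Topological.sort (X j)) i d).

Section cover.
Variable C : set (set P).
Hypothesis openC : forall U, C U -> open U.
Hypothesis coverC : \bigcup_(U in C) U = setT.

Let covered (A : set P) :=
  exists D : set (set P), [/\ D `<=` C, countable D & A `<=` \bigcup_(U in D) U].

Let covered_bigcup T (I : set T) (A : T -> set P) : countable I ->
  (forall i, I i -> covered (A i)) -> covered (\bigcup_(i in I) A i).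
Proof.
move=> cI covA.
have /choice[D DA] : forall i, exists D : set (set P), I i ->
    [/\ D `<=` C, countable D & A i `<=` \bigcup_(U in D) U].
  move=> i; have [Ii|nIi] := pselect (I i); last by exists set0.
  by have [D] := covA i Ii; exists D.
exists (\bigcup_(i in I) D i); split.
- by move=> U [i Ii DU]; have [DC _ _] := DA i Ii; exact: DC.
- by apply: bigcup_countable => // i Ii; have [] := DA i Ii.
- move=> x [i Ii Ax]; have [_ _ /(_ x Ax)[U DU Ux]] := DA i Ii.
  by exists U => //; exists i.
Qed.

Let small (q : P) n := exists V : forall i, set (X i), exists W : set P,
  [/\ forall i, (i < n)%N -> nbhs (q i) (V i), C W &
    forall y : P, (forall i, (i < n)%N -> V i (y i)) -> W y].

Let small_ex q : exists n, small q n.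
Proof.
have [W CW Wq] : (\bigcup_(U in C) U) q by rewrite coverC.
have : nbhs q W by apply: open_nbhs_nbhs; split=> //; exact: openC.
by move=> /nbhs_seqP[n [V [qV VW]]]; exists n, V, W.
Qed.

(** A pair [s] is a stage of the descent: [s.1] is the set of fixed coordinates and [s.2] carries
    their values. *)
Let cylinder (s : set nat * P) := [set x : P | forall i, s.1 i -> x i = s.2 i].

Let extend (s : set nat * P) (t : pts) : set nat * P :=
  (s.1 `|` [set tag t], dfwith s.2 (tag t) (tagged t)).

(** Keeping the free coordinates at [p] makes their neighbourhoods co-countable, so that only
    countably many extensions matter. *)
Let bad (s : set nat * P) :=
  ~ covered (cylinder s) /\ forall i, ~ s.1 i -> s.2 i = p i.

Hypothesis cocountable : cocountable_nbhs p.

(* Since the box has minimal length, the coordinate fixed next is bounded by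
   the length of every box around q lying in a member of the cover. *)
Let bad_extend s : bad s -> exists t : pts,
  [/\ ~ s.1 (tag t), bad (extend s t) &
    forall m, small s.2 m -> (tag t < m)%N].
Proof.
case: s => J q [/= ncov qp].
have exsm : exists n, `[< small q n >].
  by have [n smn] := small_ex q; exists n; apply/asboolP.
case: (ex_minnP exsm) => n /asboolP[V [W [qV CW VW]]] minn.
(* A point of the cylinder can leave the box only through a pair in [D]. The interior appears
   because co-countability concerns open sets. *)
pose D : set pts := [set t | [/\ (tag t < n)%N, ~ J (tag t) &
  ~ (V (tag t))° (tagged t)]].
have cD : countable D.
  have -> : D = \bigcup_(i in [set i | (i < n)%N /\ ~ J i])
      ((fun d => pt i d) @` ~` (V i)°).
    apply/seteqP; split=> [[i d] [/= ltin Ji Vd]|_ [i [ltin Ji] [d Vd <-]]//].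
    by exists i => //; exists d.
  apply: bigcup_countable => [|i [ltin Ji]]; first exact: countableP.
  apply: countable_image; apply: cocountable; first exact: open_interior.
  by rewrite -(qp i Ji); exact: qV.
have [[t Dt ncovt]|allcov] :=
    pselect (exists2 t, D t & ~ covered (cylinder (extend (J, q) t))).
  exists t; case: Dt => ltn Jt Vt; split=> //=.
    split=> // i /= /not_orP[Ji it]; rewrite dfwithout ?qp//.
    by apply/eqP => ti; apply: it.
  by move=> m smm; apply: leq_trans ltn _; apply: minn; exact/asboolP.
(* Each point of the cylinder lies in the box, hence in [W], or in one of the countably many
   extensions indexed by [D]. *)
exfalso; apply: ncov.
have : covered (\bigcup_(t in D) cylinder (extend (J, q) t)).
  by apply: covered_bigcup => // t Dt; apply: contrapT => nc; apply: allcov; exists t.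
move=> [D' [D'C cD' covD']]; exists (W |` D'); split.
- by move=> U [->//|/D'C].
- exact: countable_setU.
move=> x xJ; have [xV|/existsNP[i /not_implyP[ltin nV]]] :=
    pselect (forall i, (i < n)%N -> V i (x i)).
  by exists W; [left|exact: VW].
have Ji : ~ J i.
  by move=> Ji; apply: nV; rewrite (xJ i Ji); exact: nbhs_singleton (qV i ltin).
have [U D'U Ux] : (\bigcup_(U in D') U) x.
  apply: covD'; exists (pt i (x i)).
    by split=> //= /interior_subset.
  move=> j /= [Jj|->]; last by rewrite dfwithin.
  rewrite dfwithout; first exact: xJ.
  by apply/eqP => ij; apply: Ji; rewrite ij.
by exists U => //; right.
Qed.

Let cover_countable : covered setT.
Proof.
apply: contrapT => ncov.
have /choice[f fP] : forall s, exists t : pts, bad s ->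
  [/\ ~ s.1 (tag t), bad (extend s t) &
    forall m, small s.2 m -> (tag t < m)%N].
  move=> s; have [bs|nbs] := pselect (bad s); last by exists (Tagged X (p 0%N)).
  by have [t] := bad_extend bs; exists t.
pose st k := iter k (fun s => extend s (f s)) (set0, p : P).
have bst k : bad (st k).
  elim: k => [|k /fP[]//]; split=> //= -[D [DC cD covD]]; apply: ncov.
  by exists D; split=> // x _; apply: covD.
have mono k l : (k <= l)%N -> (st k).1 `<=` (st l).1 /\
    forall i, (st k).1 i -> (st l).2 i = (st k).2 i.
  elim: l => [|l IHl]; first by rewrite leqn0 => /eqP ->; split.
  rewrite leq_eqVlt => /orP[/eqP->|]; first by split.
  rewrite ltnS => /IHl[Jkl qkl].
  split=> [i /Jkl Ji|i Ji] /=; first by left.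
  rewrite dfwithout ?qkl//; apply/eqP => fi.
  by have [+ _ _] := fP _ (bst l); apply; rewrite fi; exact: Jkl.
(* The limit of the stages: a coordinate that is ever fixed keeps its value, the others stay at
   [p]. *)
pose qoo : P := fun i => if pselect (exists k, (st k).1 i) is left h
  then (st (sval (cid h))).2 i else p i.
have qooE k i : ((exists l, (st l).1 i) -> (st k).1 i) -> (st k).2 i = qoo i.
  rewrite /qoo; case: pselect => [h /(_ h) Jk|nh _].
    case: (cid h) => l Jl /=; have [kl|lk] := leqP k l.
      by have [_ /(_ i Jk) ->] := mono _ _ kl.
    by have [_ /(_ i Jl) ->] := mono _ _ (ltnW lk).
  have [_] := bst k; apply => Jk.
  by apply: nh; exists k.
have [m [V [W [qV CW VW]]]] := small_ex qoo.
have [k0 k0P] : exists k0, forall i, (i < m)%N ->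
    (exists l, (st l).1 i) -> (st k0).1 i.
  elim: m {qV VW} => [|m [k0 IHm]]; first by exists 0%N.
  have [[l Jl]|nJ] := pselect (exists l, (st l).1 m); last first.
    exists k0 => i; rewrite ltnS leq_eqVlt => /orP[/eqP->//|]; exact: IHm.
  exists (maxn k0 l) => i; rewrite ltnS leq_eqVlt => /orP[/eqP-> _|im hi].
    by have [+ _] := mono _ _ (leq_maxr k0 l); apply.
  by have [+ _] := mono _ _ (leq_maxl k0 l); apply; exact: IHm.
(* Stage [k0] agrees with [qoo] below [m], so the same box forces the next fixed coordinate below
   [m], where by the choice of [k0] nothing new can be fixed. *)
have [nJ _ ltm] := fP _ (bst k0).
have fm : (tag (f (st k0)) < m)%N.
  apply: ltm; exists V, W; split=> // i im.
  by rewrite qooE; [exact: qV|exact: k0P].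
by apply/nJ/k0P => //; exists k0.+1; right.
Qed.

Lemma cocountable_countable_subcover : exists D : set (set P),
  [/\ D `<=` C, countable D & \bigcup_(U in D) U = setT].
Proof.
have [D [DC cD covD]] := cover_countable; exists D; split=> //.
by apply/seteqP; split.
Qed.

End cover.

Lemma cocountable_lindelof : cocountable_nbhs p -> lindelof P.
Proof. by move=> cp C oC covC; exact: cocountable_countable_subcover. Qed.

End Lindelof.

(** * Countable tightness *)

(** Serves to replace a set having countably many traces by a countable subset with the same
    traces. *)
Lemma countable_image_section T U (h : T -> U) (A : set T) :
  countable (h @` A) ->
  exists B : set T, [/\ B `<=` A, countable B & h @` A `<=` h @` B].
Proof.
move=> cA; have [A0|/set0P[a0 Aa0]] := eqVneq A set0.
  by exists set0; split=> //; rewrite A0.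
have /choice[s sP] : forall u, exists a, (h @` A) u -> A a /\ h a = u.
  move=> u; have [[a Aa hau]|nu] := pselect ((h @` A) u); first by exists a.
  by exists a0.
exists (s @` (h @` A)); split; last 1 first.
- by move=> u Au; exists (s u); [exists u|have [] := sP u Au].
- by move=> _ [u Au <-]; have [] := sP u Au.
- exact: countable_image.
Qed.

Lemma countable_seqs (T : eqType) (S : set T) : countable S ->
  countable [set l : seq T | forall d, d \in l -> S d].
Proof.
move=> /countable_injP[f finj]; apply/countable_injP.
exists (fun l => pickle (map f l)) => l l' /set_mem Sl /set_mem Sl'.
move=> /(pcan_inj pickleK).
elim: l l' Sl Sl' => [|d l IHl] [|d' l']//= Sl Sl' [/finj ffd /IHl ->].
- by rewrite ffd// inE; [apply: Sl|apply: Sl']; exact: mem_head.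
- by move=> e el; apply: Sl; rewrite inE el orbT.
- by move=> e el; apply: Sl'; rewrite inE el orbT.
Qed.

Section tightness.
Context {X : nat -> topologicalType}.
Variable p : forall i, X i.
Hypothesis isolatedX : forall i (y : X i), y <> p i -> open [set y].
Local Notation P := (prod_topology X).
Local Notation pts := {i : nat & X i}.
Local Notation pt i d := (existT (fun j => Topological.sort (X j)) i d).
Hypothesis groX : grothendieck P.
Implicit Types (x y z a b : P).

Section finite_coordinates.
Variable n : nat.
Implicit Types (F J : {set 'I_n}) (V W : forall i, set (X i)) (A B : set P).

Let box F V : set P := [set y : P | forall i : 'I_n, i \in F -> V i (y i)].

Let agree F (y z : P) := forall i : 'I_n, i \in F -> z i = y i.

(** This is closure in a finite subproduct: the projection of [p] to the coordinates [F] is adherent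
    to that of [A]. *)
Let meets F A := forall V, (forall i, nbhs (p i) (V i)) -> A `&` box F V !=set0.

Let nbhs_box F V y : (forall i : 'I_n, i \in F -> nbhs (y i) (V i)) ->
  nbhs y (box F V).
Proof.
move=> yV.
have : nbhs y [set z : P | forall i : 'I_n, i \in F -> V i (z i)].
  apply: (@filter_forall P 'I_n (fun i z => i \in F -> V i (z i)) (nbhs y)) => i.
  have [iF|niF] := boolP (i \in F); last exact: filterE.
  have : nbhs y ((fun z : P => z i) @^-1` V i).
    by apply: continuous_proj_seq; exact: yV.
  by apply: filterS => z.
by [].
Qed.

Let meets0 F A : meets F A -> A !=set0.
Proof. by move=> /(_ (fun=> setT))[i|a [Aa _]]; [exact: filterT|exists a]. Qed.

Let coincide F y := [set i in F | y i == p i]%SET.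

(* A point of the closure that no countable subset reaches yields, after
   shrinking A around p, a set G all of whose countable traces are clopen. *)
Let meets_countable F A : meets F A ->
  exists B, [/\ B `<=` A, countable B & meets F B].
Proof.
have [m] := ubnP #|F|; elim: m F A => // m IHm F A; rewrite ltnS => Fm mA.
have [[a Aa ap]|noa] := pselect (exists2 a, A a & agree F p a).
  exists [set a]; split; [by move=> _ ->|exact: countable1|].
  move=> V pV; exists a; split=> // i /ap ->; exact: nbhs_singleton.
apply: contrapT => noB.
have F0 : F != finset.set0.
  apply/eqP => F0; have [a Aa] := meets0 mA; apply: noa; exists a => // i.
  by rewrite F0 inE.
pose E J : set P := [set y | meets J (A `&` [set z | agree (F :\: J) y z])].
(* Otherwise induction gives countably many [y] in [E J] and, for each, a countable part of its
   slice; their union contradicts [noB]. *)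
have nE J : J \proper F -> J != finset.set0 -> ~ meets (F :\: J) (E J).
  move=> JF J0 mE.
  have ltJ : (#|J| < m)%N by apply: leq_trans Fm; exact: proper_card.
  have ltFJ : (#|F :\: J| < m)%N.
    apply: leq_trans Fm; rewrite cardsD.
    have -> : (F :&: J = J)%SET by apply/finset.setIidPr; exact: proper_sub.
    rewrite ltn_subrL card_gt0 J0/= (leq_trans _ (proper_card JF))//.
  have [E' [E'E cE' mE']] := IHm _ _ ltFJ mE.
  have /choice[By ByP] : forall y, exists B, E' y ->
      [/\ B `<=` A `&` [set z | agree (F :\: J) y z], countable B & meets J B].
    move=> y; have [E'y|nE'y] := pselect (E' y); last by exists set0.
    by have [B BP] := IHm _ _ ltJ (E'E _ E'y); exists B.
  apply: noB; exists (\bigcup_(y in E') By y); split.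
  - by move=> z [y E'y Bz]; have [/(_ z Bz)[]] := ByP y E'y.
  - by apply: bigcup_countable => // y E'y; have [] := ByP y E'y.
  move=> V pV; have [y [E'y yV]] := mE' V pV.
  have [ByA _ /(_ V pV)[z [Bz zV]]] := ByP y E'y.
  exists z; split; first by exists y.
  move=> i iF; have [iJ|niJ] := boolP (i \in J); first exact: zV.
  have iFJ : i \in (F :\: J)%SET by rewrite inE niJ.
  by have [_ /(_ i iFJ) ->] := ByA z Bz; exact: yV.
have /choice[VJ VJP] : forall J, exists V, (forall i, nbhs (p i) (V i)) /\
    (J \proper F -> J != finset.set0 -> forall y, E J y -> ~ box (F :\: J) V y).
  move=> J; have [[JF J0]|nJ] := pselect (J \proper F /\ J != finset.set0).
    have /existsNP[V /not_implyP[pV /forallNP nV]] := nE J JF J0.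
    by exists V; split=> // _ _ y Ey yV; apply: (nV y).
  exists (fun=> setT); split=> [i|JF J0]; first exact: filterT.
  by exfalso; apply: nJ.
(* There are finitely many [J], so one family of neighbourhoods avoids every [E J] with [J] nonempty
   and proper. *)
pose U i : set (X i) := [set d | forall J, VJ J i d].
have pU i : nbhs (p i) (U i).
  have : \forall d \near p i, forall J, VJ J i d.
    by apply: filter_forall => J; have [+ _] := VJP J; apply.
  by [].
have properJ y : ~ agree F p y -> coincide F y \proper F.
  move=> nag; rewrite properE; apply/andP; split.
    by apply/fintype.subsetP => i; rewrite inE => /andP[].
  apply/negP => /fintype.subsetP FJ; apply: nag => i /FJ.
  by rewrite inE => /andP[_ /eqP].
have notU y : ~ agree F p y -> coincide F y != finset.set0 ->
    E (coincide F y) y -> exists2 i : 'I_n, i \in (F :\: coincide F y)%SET & ~ U i (y i).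
  move=> nag J0 EJ; have [_ /(_ (properJ _ nag) J0 y EJ)] := VJP (coincide F y).
  move=> /existsNP[i /not_implyP[iFJ nV]]; by exists i => // Ui; apply: nV; exact: Ui.
(* With [J] the coordinates of [F] where [a] equals [p], the point [a] lies in [E J] as its own
   witness; so [J] must be empty. *)
have ap a i : A a -> box F U a -> i \in F -> a i <> p i.
  move=> Aa aU iF aip.
  have J0 : coincide F a != finset.set0.
    by apply/set0Pn; exists i; rewrite inE iF aip eqxx.
  have nag : ~ agree F p a by move=> ag; apply: noa; exists a.
  have [|j jFJ] := notU a nag J0.
    move=> V pV; exists a; split; first by split.
    by move=> j; rewrite inE => /andP[_ /eqP ->]; exact: nbhs_singleton.
  by apply; apply: aU; move: jFJ; rewrite inE => /andP[].
pose G : set P := [set y | exists2 a, A a /\ box F U a & agree F a y].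
have Gp y : agree F p y -> ~ G y.
  move=> yp [a [Aa aU] ya]; have /set0Pn[i iF] := F0.
  by apply: (ap a i Aa aU iF); rewrite -(ya i iF); exact: yp.
have nbhs_agree y F' : (forall i : 'I_n, i \in F' -> y i <> p i) ->
    nbhs y [set z | agree F' y z].
  move=> yp; apply: (@nbhs_box F' (fun i => [set d | d = y i])) => i iF.
  by apply: (nbhs_isolated isolatedX) => //; exact: yp.
have openG y : G y -> nbhs y G.
  move=> [a [Aa aU] ya].
  have : nbhs y [set z | agree F y z].
    by apply: nbhs_agree => i iF; rewrite ya//; exact: ap.
  apply: filterS => z zy; exists a => // i iF.
  by rewrite (zy i iF) ya.
(* Points near [y] share its isolated coordinates. These exclude [G] if [J] is empty or if [U] fails
   at one of them; otherwise a box around [p] in the coordinates [J] misses the slice of [A] through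
   [y]. *)
have closedG y : ~ agree F p y -> ~ G y -> nbhs y (~` G).
  move=> nag nG; pose J := coincide F y.
  have yFJ : nbhs y [set z | agree (F :\: J) y z].
    apply: nbhs_agree => i; rewrite !inE => /andP[+ iF].
    by rewrite iF/= => /eqP.
  have [J0|J0] := eqVneq J finset.set0.
    apply: filterS yFJ => z zy [a Aa za]; apply: nG; exists a => // i iF.
    by rewrite -(za i iF) (zy i)// J0 !inE.
  have [EJ|] := pselect (E J y).
    have [i iFJ nU] := notU y nag J0 EJ.
    apply: filterS yFJ => z zy [a [Aa aU] za]; apply: nU.
    have iF : i \in F by move: iFJ; rewrite inE => /andP[].
    by rewrite -(zy i iFJ) (za i iF); exact: aU.
  move=> /existsNP[W /not_implyP[pW nW]].
  have yJ : nbhs y (box J W).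
    by apply: nbhs_box => i; rewrite inE => /andP[_ /eqP ->].
  apply: filterS (filterI yFJ yJ) => z [zy zW] [a [Aa aU] za]; apply: nW.
  exists a; split.
    split=> // i iFJ; rewrite -(zy i iFJ) za//.
    by move: iFJ; rewrite inE => /andP[].
  move=> i iJ; have iF : i \in F by move: iJ; rewrite inE => /andP[].
  by rewrite -(za i iF); exact: zW.
pose g x : R := if `[< G x >] then 1%R else 0%R.
have g_const y (N : set P) : nbhs y N -> (forall z, N z -> (G z <-> G y)) ->
    {for y, continuous g}.
  move=> yN NG; apply/continuous_at_realP => e e0.
  apply: filterS yN => z /NG Gzy /=.
  by rewrite /g (propext Gzy) subrr normr0.
have cgS (S : set pts) : countable S -> continuous (fun x => g (retract p S x)).
  move=> cS y; have [yp|nyp] := pselect (agree F p (retract p S y)); last first.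
    apply: (@continuous_comp P P R (retract p S) g).
      exact: continuous_retract.
    have [Gy|nGy] := pselect (G (retract p S y)).
      by apply: g_const (openG _ Gy) _ => z Gz; split.
    by apply: g_const (closedG _ nyp nGy) _ => z Gz; split.
  (* Only countably many lists have entries in [S], so a countable [B] realises every [h a] with [a]
     in [B']. By [noB] some box around [p] misses [B], and near [y] no retracted point can then lie
     in [G]. *)
  pose h (a : P) := [seq pt (nat_of_ord i) (a i) | i : 'I_n <- enum F].
  pose B' := [set a | [/\ A a, box F U a & forall d, d \in h a -> S d]].
  have [|B [BB' cB hB]] := @countable_image_section _ _ h B'.
    apply: countable_subset (countable_seqs cS) => _ [a [_ _ aS] <-].
    exact: aS.
  have /existsNP[V /not_implyP[pV nV]] : ~ meets F B.
    move=> mB; apply: noB; exists B; split=> // b /BB'[]//.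
  have yV : nbhs y [set z | box F V (retract p S z)].
    apply: (continuous_retract isolatedX); apply: nbhs_box => i iF.
    by rewrite yp.
  apply/continuous_at_realP => e e0; apply: filterS yV => z zV /=.
  have nGz : ~ G (retract p S z).
    move=> [a [Aa aU] za]; apply: nV.
    have [|b Bb hba] := hB (h a).
      exists a => //; split=> // d /mapP[i]; rewrite mem_enum => iF ->.
      have nai := ap a i Aa aU iF.
      have [Sz|nSz] := pselect (S (pt i (z i))).
        by have := za i iF; rewrite retract_in// => <-.
      by exfalso; apply: nai; rewrite -(za i iF) retract_notin.
    exists b; split=> // i iF.
    have : pt i (b i) = pt i (a i).
      by have /eq_in_map := hba; apply; rewrite mem_enum.
    move=> /eqP; rewrite eq_Tagged /= => /eqP ->.
    by rewrite -(za i iF); exact: zV.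
  by rewrite /g !asboolF// ?subrr ?normr0//; exact: Gp.
have [S cS gS] := countable_retracts_factor groX cgS.
have : {for (p : P), continuous g}.
  by have := cgS S cS p; congr (continuous_at _ _); apply/funext.
move=> /continuous_at_realP/(_ 1%R ltr01)/nbhs_seqP[k [V [pV VG]]].
have [a [Aa aVU]] := mA (fun i => V i `&` U i) (fun i => filterI (pV i) (pU i)).
(* Only the coordinates of [a] in [F] are controlled. Resetting the others to [p] puts [z] near [p]
   and keeps it in [G], against the continuity of [g] at [p]. *)
pose z : P := fun j => if `[< exists2 i : 'I_n, i \in F & i = j :> nat >]
  then a j else p j.
have Gz : G z.
  exists a; first by split=> // i iF; have [] := aVU i iF.
  by move=> i iF; rewrite /z asboolT//; exists i.
have : (`|g z - g p| < 1)%R.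
  apply: VG => i _; rewrite /z; case: asboolP => [[j jF <-]|_].
    by have [] := aVU j jF.
  exact: nbhs_singleton.
by rewrite /g asboolT// asboolF ?subr0 ?normr1 ?ltxx//; exact: Gp.
Qed.

(** Below [n], coordinates where [x] differs from [p] are isolated, so [A] may be cut down to the
    points sharing them; [meets_countable] handles the remaining ones. *)
Lemma countable_tightness_prefix A x : closure A x ->
  exists B, [/\ B `<=` A, countable B & forall V, (forall i, nbhs (x i) (V i)) ->
    exists2 b, B b & forall i, (i < n)%N -> V i (b i)].
Proof.
move=> clA; pose F := [set i : 'I_n | x i == p i]%SET.
pose A' := A `&` [set y | forall i : 'I_n, i \notin F -> y i = x i].
have [|B [BA' cB mB]] := @meets_countable F A'.
  move=> V pV.
  pose W i : set (X i) := [set d | (x i = p i -> V i d) /\ (x i <> p i -> d = x i)].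
  have xW : nbhs x (box finset.setT W).
    apply: nbhs_box => i _; have [xp|xp] := pselect (x i = p i).
      by have := pV i; rewrite -xp; apply: filterS => d Vd; split.
    by apply: (nbhs_isolated isolatedX) => //; split.
  have [y [Ay yW]] := clA _ xW; exists y; split.
    split=> // i; rewrite inE => /eqP xp.
    by have [|_] := yW i; [rewrite inE|apply].
  move=> i; rewrite inE => /eqP xp.
  by have [|+ _] := yW i; [rewrite inE|apply].
exists B; split=> // [b /BA'[]//|V xV].
have [|b [Bb bV]] := mB (fun i => [set d | x i = p i -> V i d]).
  move=> i; have [xp|xp] := pselect (x i = p i); last by apply: filterE => d /xp.
  by have := xV i; rewrite xp; apply: filterS => d Vd.
exists b => // i ltin; have [_ bx] := BA' b Bb.
have [xp|xp] := pselect (x i = p i).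
  by apply: (bV (Ordinal ltin)) => //; rewrite inE; exact/eqP.
rewrite (bx (Ordinal ltin)); first exact: nbhs_singleton.
by rewrite inE; exact/eqP.
Qed.

End finite_coordinates.

Lemma grothendieck_countable_tightness : countable_tightness P.
Proof.
move=> A x clA.
have /choice[B BP] n := countable_tightness_prefix n clA.
exists (\bigcup_n B n); split.
- by move=> b [n _ Bb]; have [BA _ _] := BP n; exact: BA.
- by apply: bigcup_countable => // n _; have [] := BP n.
move=> U /nbhs_seqP[n [V [xV VU]]].
have [_ _ /(_ V xV)[b Bb bV]] := BP n.
by exists b; split; [exists n|exact: VU].
Qed.

End tightness.

(** * Relatively countably compact sets of functions *)

Lemma eq_real_approx (r s : R) :
  (forall e : R, (0 < e)%R -> (`|r - s| < e)%R) -> r = s.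
Proof.
move=> rs; apply/eqP; rewrite -subr_eq0 -normr_eq0; apply/negPn/negP => nz.
have /rs : (0 < `|r - s|)%R by rewrite lt_def nz normr_ge0.
by rewrite ltxx.
Qed.

Lemma small_invn (e : R) : (0 < e)%R -> exists n, (n.+1%:R^-1 < e)%R.
Proof. by move=> /ltr_add_invr[n]; rewrite add0r; exists n. Qed.

Lemma le_invn (m n : nat) : (m <= n)%N -> (n.+1%:R^-1 <= m.+1%:R^-1 :> R)%R.
Proof. by move=> mn; rewrite lef_pV2 ?posrE ?ltr0n// ler_nat. Qed.

Section relatively_countably_compact_functions.
Context {T : topologicalType}.
Variables A Z : set {ptws T -> R}.
Hypothesis AZ : A `<=` Z.
Hypothesis limA : forall B : set {ptws T -> R}, B `<=` A -> infinite_set B ->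
  exists2 z, Z z & limit_point B z.

(** Enumerate [Y] and approximate [f] ever better on growing finite parts of it: every cluster point
    of the approximants equals [f] on [Y]. *)
Lemma pointwise_cluster_on_countable (A0 : set {ptws T -> R}) (Y : set T)
    (f : T -> R) : A0 `<=` A -> countable Y ->
  (forall (s : seq T) k, (forall y, y \in s -> Y y) ->
    exists2 a, A0 a & forall y, y \in s -> (`|a y - f y| < k.+1%:R^-1)%R) ->
  exists2 z, Z z & closure A0 z /\ forall y, Y y -> z y = f y.
Proof.
move=> A0A /countable_injP[phi phi_inj] approx.
have /choice[s sP] n : exists s : seq T, (forall y, y \in s -> Y y) /\
    forall y, Y y -> (phi y < n)%N -> y \in s.
  elim: n => [|n [s [sY Ys]]]; first by exists [::].
  have [[y Yy yn]|noy] := pselect (exists2 y, Y y & phi y = n).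
    exists (y :: s); split=> [x|x Yx].
      by rewrite inE => /orP[/eqP->//|]; exact: sY.
    rewrite ltnS leq_eqVlt inE => /orP[/eqP xn|/(Ys _ Yx) ->]; last by rewrite orbT.
    by rewrite (phi_inj x y) ?eqxx// ?inE// xn yn.
  exists s; split=> // x Yx; rewrite ltnS leq_eqVlt => /orP[/eqP xn|]; last exact: Ys.
  by exfalso; apply: noy; exists x.
have /choice[a aP] n : exists a, A0 a /\
    forall y, y \in s n -> (`|a y - f y| < n.+1%:R^-1)%R.
  by have [sY _] := sP n; have [a] := approx (s n) n sY; exists a.
have [|z Zz clz] := sequence_cluster_point accessible_ptws AZ limA (u := a).
  by move=> n; apply: A0A; have [] := aP n.
exists z => //; split=> [U /(clz U 0%N)[n _ Un]|y Yy].
  by exists (a n); split=> //; have [] := aP n.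
apply: eq_real_approx => e e0.
have e20 : (0 < e / 2)%R by lra.
have [N Ne] := small_invn e20.
have [n Nn /(_ y (mem_head _ _)) anz] :=
  clz _ (maxn N (phi y).+1) (nbhs_ptws_ball z [:: y] e20).
have [Nn' yn] : (N <= n)%N /\ (phi y < n)%N by apply/andP; rewrite -geq_max.
have anf : (`|a n y - f y| < e / 2)%R.
  have [_ /(_ y)] := aP n; have [_ /(_ y Yy yn) ys] := sP n.
  by move=> /(_ ys) /lt_trans; apply; apply: le_lt_trans (le_invn Nn') Ne.
rewrite -[X in (`|X| < _)%R](subrKA (a n y)).
rewrite (le_lt_trans (ler_normD _ _))// distrC.
by rewrite [X in (_ < X)%R]splitr ltrD.
Qed.

(** A sequence with [|a n x| > n] has no cluster point, as its terms leave the unit interval around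
    any value at [x]. *)
Lemma pointwise_bounded x : exists M : R, forall a, A a -> (`|a x| <= M)%R.
Proof.
apply: contrapT => unbounded.
have /choice[a aP] n : exists a, A a /\ (n%:R < `|a x|)%R.
  apply: contrapT => noa; apply: unbounded; exists (n%:R)%R => a Aa.
  by rewrite leNgt; apply/negP => na; apply: noa; exists a.
have [|z Zz clz] := sequence_cluster_point accessible_ptws AZ limA (u := a).
  by move=> n; have [] := aP n.
have [n Nn /(_ x (mem_head _ _)) anz] :=
  clz _ (Num.truncn (`|z x| + 1)).+1 (nbhs_ptws_ball z [:: x] ltr01).
have [_ nan] := aP n.
have zn : (`|z x| + 1 < n%:R)%R.
  by apply: lt_le_trans (truncnS_gt _) _; rewrite ler_nat.
have : (`|a n x| <= `|a n x - z x| + `|z x|)%R.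
  by rewrite -[X in (`|X| <= _)%R](subrK (z x)) ler_normD.
by lra.
Qed.

(** Pointwise bounds place the closure in a product of segments, compact by Tychonoff. *)
Lemma compact_closure : compact (closure A).
Proof.
have /choice[M MA] := pointwise_bounded.
have cK : compact [set f : {ptws T -> R} | forall x, `[(- M x)%R, M x] (f x)].
  apply: (@tychonoff T (fun=> R) (fun x => `[(- M x)%R, M x])) => x.
  exact: segment_compact.
apply: (subclosed_compact _ cK); first exact: closed_closure.
have : closed [set f : {ptws T -> R} | forall x, `[(- M x)%R, M x] (f x)].
  apply: compact_closed cK; apply: (@hausdorff_product T (fun=> R)) => _.
  exact: Rhausdorff.
move=> /closure_id ->.
apply: closure_subset => a Aa x /=.
by rewrite in_itv/= -ler_norml; exact: MA.
Qed.

Hypothesis ZC : Z `<=` @Cp T.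

Lemma closure_approx (f : {ptws T -> R}) (s : seq T) k : closure A f ->
  exists2 a, A a & forall y, y \in s -> (`|a y - f y| < k.+1%:R^-1)%R.
Proof.
have k0 : (0 < k.+1%:R^-1 :> R)%R by rewrite invr_gt0 ltr0n.
by move=> /(_ _ (nbhs_ptws_ball f s k0))[a [Aa af]]; exists a.
Qed.

(** If [f] is discontinuous at [x], tightness gives a countable [B] adherent to [x] on which [f]
    stays away from [f x]. Some continuous function agrees with [f] on [B] and at [x], a
    contradiction. *)
Lemma closure_continuous : countable_tightness T -> closure A `<=` @Cp T.
Proof.
move=> tT f clf x; apply/continuous_at_realP => e e0; apply: contrapT => nx.
pose E := [set y | ~ (`|f y - f x| < e)%R].
have [U Ux|B [BE cB clB]] := tT E x.
  apply: contrapT => /set0P/negP/negPn/eqP EU; apply: nx; apply: filterS Ux => y Uy.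
  apply: contrapT => nfy; suff : (E `&` U) y by rewrite EU.
  by split.
have [||z Zz [_ zf]] :=
    @pointwise_cluster_on_countable A (x |` B) f (fun _ h => h).
- by apply: countable_setU => //; exact: countable1.
- by move=> s k _; exact: closure_approx.
have cz : continuous (z : T -> R) by exact: ZC.
have /clB[y [By zyx]] := (continuous_at_realP _ _).1 (cz x) e e0.
by apply: (BE y By); rewrite -!zf//; [left|right].
Qed.

End relatively_countably_compact_functions.

(** * From tightness and the Lindelof property to Grothendieck *)

Section converse.
Context {X : nat -> topologicalType}.
Variable p : forall i, X i.
Hypothesis isolatedX : forall i (y : X i), y <> p i -> open [set y].
Local Notation P := (prod_topology X).
Local Notation pts := {i : nat & X i}.
Local Notation pt i d := (existT (fun j => Topological.sort (X j)) i d).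
Local Notation retract := (retract p).
Implicit Types (x y z : P) (S : set pts).

Hypothesis lindelofX : lindelof P.

Let saturated S (W : set P) := forall S', S `<=` S' ->
  forall y, W y -> W (retract S' y).

(** In a suitable box, coordinates with [x i] different from [p i] are frozen at [x i], and [S]
    retains them; the others can only move to [p i], which the box allows. *)
Let nbhs_saturated x (N : set P) : nbhs x N -> exists W : set P,
  [/\ open W, W x, W `<=` N & exists2 S, countable S & saturated S W].
Proof.
move=> /nbhs_seqP[n [V [xV VN]]].
pose B i := [set d : X i | (x i = p i -> (V i)° d) /\ (x i <> p i -> d = x i)].
have oB i d : B i d -> nbhs d (B i).
  move=> [Vd xd]; have [xp|xp] := pselect (x i = p i).
    have : nbhs d (V i)° by apply: open_nbhs_nbhs; split; [exact: open_interior|exact: Vd].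
    by apply: filterS => d' Vd'; split.
  rewrite (xd xp); apply: (nbhs_isolated isolatedX) => //; by split.
exists [set y : P | forall i, (i < n)%N -> B i (y i)]; split.
- rewrite openE => y yB; apply: nbhs_seq_box => i /yB; exact: oB.
- by move=> i ltin; split=> // _; exact: xV.
- move=> y yB; apply: VN => i ltin; have [Vy xy] := yB i ltin.
  have [/Vy/interior_subset//|xp] := pselect (x i = p i).
  by rewrite (xy xp); exact: nbhs_singleton.
exists (range (fun i => pt i (x i))); first exact: countable_image.
move=> S' SS' y yB i ltin; have [Vy xy] := yB i ltin.
have [xp|xp] := pselect (x i = p i).
  split=> // _; apply: retract_ind; first exact: Vy.
  by rewrite -xp; exact: xV.
rewrite retract_in; first exact: yB.
by apply: SS'; rewrite (xy xp); exists i.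
Qed.

(** Countably many saturated open sets of small oscillation cover the product, and a point shares
    one of them with its retraction. The supports are united over the cover and over [k]. *)
Lemma continuous_countable_support (f : P -> R) : continuous f ->
  exists2 S, countable S &
    forall S', S `<=` S' -> forall x, f (retract S' x) = f x.
Proof.
move=> cf.
have /choice[S SP] k : exists S, countable S /\ forall S', S `<=` S' ->
    forall x, (`|f (retract S' x) - f x| < k.+1%:R^-1)%R.
  pose C := [set W : set P | [/\ open W, exists2 S, countable S & saturated S W &
    forall y z, W y -> W z -> (`|f y - f z| < k.+1%:R^-1)%R]].
  have [W []//||D [DC cD covD]] := lindelofX (C := C).
    apply/seteqP; split=> // x _.
    have k0 : (0 < k.+1%:R^-1 / 2 :> R)%R by rewrite divr_gt0// invr_gt0 ltr0n.
    have /nbhs_saturated[W [oW Wx WN SW]] := (continuous_at_realP _ _).1 (cf x) _ k0.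
    exists W => //; split=> // y z /WN/= yx /WN/= zx.
    rewrite -[X in (`|X| < _)%R](subrKA (f x)).
    rewrite (le_lt_trans (ler_normD _ _))// [X in (_ + X < _)%R]distrC.
    by rewrite [X in (_ < X)%R]splitr ltrD.
  have /choice[SW SWP] : forall W, exists S, D W -> countable S /\ saturated S W.
    move=> W; have [DW|nDW] := pselect (D W); last by exists set0.
    by have [_ [S cS sS] _] := DC W DW; exists S.
  exists (\bigcup_(W in D) SW W); split.
    by apply: bigcup_countable => // W /SWP[].
  move=> S' SS' x; have [W DW Wx] : (\bigcup_(W in D) W) x by rewrite covD.
  have [_ _] := DC W DW; apply=> //; have [_ sW] := SWP W DW; apply: sW => //.
  by move=> d Sd; apply: SS'; exists W.
exists (\bigcup_k S k); first by apply: bigcup_countable => // k _; have [] := SP k.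
move=> S' SS' x; apply: eq_real_approx => e /small_invn[k ke].
apply: lt_trans ke; have [_] := SP k; apply => d Sd.
by apply: SS'; exists k.
Qed.

(** If an index recurs in [l], its first occurrence decides. *)
Definition finite_point (l : seq pts) : P :=
  foldr (fun t y => dfwith y (tag t) (tagged t)) p l.

Let finite_pointE x (s : seq nat) j :
  finite_point [seq pt i (x i) | i <- s] j = if j \in s then x j else p j.
Proof.
elim: s => //= i s IHs; rewrite inE; have [->|ji] := eqVneq j i.
  by rewrite dfwithin.
by rewrite dfwithout 1?eq_sym// IHs.
Qed.

Let Y S : set P := [set y | exists2 l : seq pts,
  (forall d, d \in l -> S d) & y = finite_point l].

Let countable_Y S : countable S -> countable (Y S).
Proof.
move=> /countable_seqs/(countable_image finite_point).
by apply: countable_subset => y [l lS ->]; exists l.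
Qed.

Let eq_on_Y S (f g : P -> R) x : continuous f -> continuous g ->
  (forall y, Y S y -> f y = g y) -> f (retract S x) = g (retract S x).
Proof.
move=> cf cg fg; set w := retract S x; apply: eq_real_approx => e e0.
have e20 : (0 < e / 2)%R by lra.
have wf := (continuous_at_realP _ _).1 (cf w) _ e20.
have wg := (continuous_at_realP _ _).1 (cg w) _ e20.
have : nbhs (w : P) ([set y : P | (`|f y - f w| < e / 2)%R] `&`
    [set y : P | (`|g y - g w| < e / 2)%R]) by exact: filterI.
move=> /nbhs_seqP[n [V [wV Vfg]]].
(* The truncation of [w] to its first [n] coordinates is in [Y S] and satisfies every constraint of
   the box. *)
pose s := [seq i <- iota 0 n | `[< S (pt i (x i)) >]].
pose y := finite_point [seq pt i (x i) | i <- s].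
have fgy : f y = g y.
  apply: fg; exists [seq pt i (x i) | i <- s] => // d /mapP[i].
  by rewrite mem_filter => /andP[/asboolP Si _] ->.
have [|/= fy gy] := Vfg y.
  move=> i ltin; suff -> : y i = w i by exact: nbhs_singleton.
  by rewrite /y finite_pointE mem_filter mem_iota/= add0n ltin andbT.
rewrite -[X in (`|X| < _)%R](subrKA (f y)) {2}fgy.
rewrite (le_lt_trans (ler_normD _ _))// distrC.
by rewrite [X in (_ < X)%R]splitr ltrD.
Qed.

(* Closing off: S absorbs the supports of countably many a in A approximating f
   on the finite subsets of Y S, which is dense in the range of r_S. *)
Lemma closure_in_subspace (A Z : set {ptws P -> R}) (f : {ptws P -> R}) :
  A `<=` Z -> Z `<=` @Cp P ->
  (forall B : set {ptws P -> R}, B `<=` A -> infinite_set B ->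
    exists2 z, Z z & limit_point B z) ->
  closure A f -> @Cp P f -> Z f.
Proof.
move=> AZ ZC limA clf cf.
have /choice[supp suppP] : forall a : P -> R, exists S, continuous a ->
    countable S /\ forall S', S `<=` S' -> forall x, a (retract S' x) = a x.
  move=> a; have [ca|nca] := pselect (continuous a); last by exists set0.
  by have [S] := continuous_countable_support ca; exists S.
have /choice[alpha alphaP] : forall sk : seq P * nat, exists a, A a /\
    forall y, y \in sk.1 -> (`|a y - f y| < sk.2.+1%:R^-1)%R.
  by move=> [s k]; have [a] := closure_approx s k clf; exists a.
have cont_alpha sk : continuous (alpha sk : P -> R).
  by apply: ZC; apply: AZ; have [] := alphaP sk.
pose K S := [set sk : seq P * nat | forall y, y \in sk.1 -> Y S y].
have cK S : countable S -> countable (K S).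
  move=> /countable_Y/countable_seqs cY.
  apply: countable_subset (countableX cY (countableP [set: nat])).
  by move=> [s k] /= sY; split.
(* Any finite subset of the final [Y S] appears at a finite stage, so the supports of its
   approximants enter one stage later. *)
pose next S := S `|` (supp f `|` \bigcup_(sk in K S) supp (alpha sk)).
pose st n := iter n next set0.
have cst n : countable (st n).
  elim: n => [|n IHn]; first exact: countable0.
  apply: countable_setU => //; apply: countable_setU; first by have [] := suppP f cf.
  apply: bigcup_countable => [|sk _]; first exact: cK.
  by have [] := suppP _ (cont_alpha sk).
have mono m n : (m <= n)%N -> st m `<=` st n.
  elim: n => [|n IHn]; first by rewrite leqn0 => /eqP ->.
  rewrite leq_eqVlt => /orP[/eqP->//|]; rewrite ltnS => /IHn mn d /mn dn.
  by left.
pose S : set pts := \bigcup_n st n.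
have YS y : Y S y -> exists n, Y (st n) y.
  move=> [l lS ->]; suff [n ln] : exists n, forall d, d \in l -> st n d.
    by exists n, l.
  elim: l lS => [|d l IHl] lS; first by exists 0%N.
  have [|n ln] := IHl; first by move=> e el; apply: lS; rewrite inE el orbT.
  have [m _ dm] := lS d (mem_head _ _).
  exists (maxn m n) => e; rewrite inE => /orP[/eqP->|/ln].
    exact: mono (leq_maxl _ _) _ dm.
  exact: mono (leq_maxr _ _) _.
have YmonoS m n : (m <= n)%N -> Y (st m) `<=` Y (st n).
  by move=> mn y [l lS ->]; exists l => // d /lS; exact: mono.
have KS s k : (forall y, y \in s -> Y S y) -> exists n, K (st n) (s, k).
  elim: s => [|y s IHs] sS; first by exists 0%N.
  have [|n sn] := IHs; first by move=> e es; apply: sS; rewrite inE es orbT.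
  have [m ym] := YS y (sS y (mem_head _ _)).
  exists (maxn m n) => e; rewrite inE => /orP[/eqP->|/sn].
    exact: YmonoS (leq_maxl _ _) _ ym.
  exact: YmonoS (leq_maxr _ _) _.
pose A0 : set {ptws P -> R} := \bigcup_n (alpha @` K (st n)).
have A0A : A0 `<=` A by move=> _ [n _ [sk _ <-]]; have [] := alphaP sk.
have cS : countable S by apply: bigcup_countable.
have [||z Zz [clz zf]] :=
    pointwise_cluster_on_countable AZ limA (Y := Y S) (f := f) A0A.
- exact: countable_Y.
- move=> s k /(KS s k)[n Kn]; exists (alpha (s, k)); first by exists n => //; exists (s, k).
  by have [_] := alphaP (s, k).
have fr x : f (retract S x) = f x.
  have [_] := suppP f cf; apply => d fd.
  by exists 1%N => //; right; left.
(* Members of [A0] have their supports inside [S], and invariance under the retraction passes to the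
   pointwise closure. *)
have zr x : z (retract S x) = z x.
  apply: eq_real_approx => e e0; have e20 : (0 < e / 2)%R by lra.
  have [a [A0a az]] := clz _ (nbhs_ptws_ball z [:: x; retract S x] e20).
  have ar : a (retract S x) = a x.
    case: A0a => n _ [sk Ksk <-]; have [_] := suppP _ (cont_alpha sk); apply => d fd.
    by exists n.+1 => //; right; right; exists sk.
  have azx : (`|a x - z x| < e / 2)%R by apply: az; exact: mem_head.
  have azr : (`|a (retract S x) - z (retract S x)| < e / 2)%R.
    by apply: az; rewrite !inE eqxx orbT.
  rewrite -[X in (`|X| < _)%R](subrKA (a (retract S x))) {2}ar.
  rewrite (le_lt_trans (ler_normD _ _))// distrC.
  by rewrite [X in (_ < X)%R]splitr ltrD.
(* Both functions factor through [retract S] and agree on [Y S], which is dense in its range. *)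
suff <- : z = f by [].
apply/funext => x; rewrite -zr -fr; apply: eq_on_Y => //; exact: ZC.
Qed.

Lemma lindelof_tight_grothendieck : countable_tightness P -> grothendieck P.
Proof.
move=> tP Z ZC A AZ limA.
suff -> : closure A `&` Z = closure A by exact: compact_closure AZ limA.
apply/setIidPl => f clf; apply: (closure_in_subspace AZ ZC limA clf).
exact: (closure_continuous AZ limA ZC tP clf).
Qed.

End converse.

Theorem theorem61 (X : nat -> topologicalType) :
  (forall i, tychonoff_space (X i)) ->
  (forall i, almost_discrete (X i)) ->
  grothendieck (prod_topology X) <->
  (countable_tightness (prod_topology X) /\ lindelof (prod_topology X)).
Proof.
move=> _ adX.
pose p i := sval (cid (adX i)).
have isoX i (y : X i) : y <> p i -> open [set y].
  rewrite /p; case: cid => x [_ xP] /= yx; apply: contrapT => /xP; exact: yx.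
split=> [groX|[tX lX]]; last exact: lindelof_tight_grothendieck isoX lX tX.
split; first exact: grothendieck_countable_tightness isoX groX.
apply: (@cocountable_lindelof X p); exact: grothendieck_cocountable isoX groX.
Qed.
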